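(* Let $n\in\mathbb{N}$ and $\varepsilon>0$ be given. If $n\geqslant 2$ and $\varepsilon<\frac{1}{3600\,n^{11}}$, then every monomial unitary group $\mathcal{G}\subseteq M_n(\mathbb{C})$ with a weak $\varepsilon$-approximate fixed point $\xi$ has a common eigenvector $\zeta$.
   Context: A unitary group $\mathcal{G}\subseteq M_n(\mathbb{C})$ is a group of unitary $n\times n$ complex matrices. It is monomial if for each $G\in\mathcal{G}$ the matrix $|G|$ of entrywise absolute values is a permutation matrix. $\mathbb{C}^n$ carries the standard inner product and $\|\cdot\|$ is the Euclidean norm. For $0<\varepsilon<1$, a vector $\xi\in\mathbb{C}^n$ with $\|\xi\|=1$ is a weak $\varepsilon$-approximate fixed point of $\mathcal{G}$ if $|\langle G\xi,\xi\rangle|\geqslant 1-\varepsilon$ for all $G\in\mathcal{G}$. A common eigenvector of $\mathcal{G}$ is a vector $\zeta$ with $\|\zeta\|=1$ such that for every $G\in\mathcal{G}$ there is a scalar $\lambda\in\mathbb{C}$ with $G\zeta=\lambda\zeta$. *)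

(* Defs.v *)
From HB Require Import structures.
From mathcomp Require Import all_boot all_order all_algebra.
From mathcomp Require Import boolp classical_sets reals complex.

Set Implicit Arguments.
Unset Strict Implicit.
Unset Printing Implicit Defensive.

Import Order.TTheory GRing.Theory Num.Theory.
Local Open Scope classical_set_scope.
Local Open Scope ring_scope.
Local Open Scope complex_scope.

Section Defs.
Variables (R : realType) (n : nat).
Local Notation C := R[i].

(* The library's [dotmx] takes row vectors; matrices act here on columns. *)
Definition inner (u v : 'cV[C]_n) : C := dotmx u^T v^T.

Lemma innerE (u v : 'cV[C]_n) : inner u v = \sum_i u i 0 * (v i 0)^*.
Proof.
rewrite /inner dotmxE mxE; apply: eq_bigr => i _.
by rewrite !mxE.
Qed.

Definition enorm (u : 'cV[C]_n) : C := sqrtC (inner u u).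

Record unitary_group (G : set 'M[C]_n) : Prop := UnitaryGroup {
  unitary_group_unitary : forall A, G A -> A \is unitarymx;
  unitary_group1 : G 1%:M;
  unitary_groupM : forall A B, G A -> G B -> G (A *m B);
  unitary_groupV : forall A, G A -> G (invmx A) }.

Definition monomial (G : set 'M[C]_n) : Prop :=
  forall A, G A -> is_perm_mx (map_mx (fun z : C => `|z|) A).

Definition weak_approx_fixed_point
    (eps : R) (G : set 'M[C]_n) (xi : 'cV[C]_n) : Prop :=
  [/\ 0 < eps < 1, enorm xi = 1 &
      forall A, G A -> (1 - eps)%:C <= `|inner (A *m xi) xi|].

Definition is_common_eigenvector (G : set 'M[C]_n) (zeta : 'cV[C]_n) : Prop :=
  enorm zeta = 1 /\
  forall A, G A -> exists lambda : C, A *m zeta = lambda *: zeta.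

End Defs.

(* Main.v *)
Require Import Defs.
From mathcomp Require Import all_boot all_order all_algebra.
From mathcomp Require Import boolp classical_sets reals complex.
From mathcomp Require Import fingroup perm ring lra.

Import Order.TTheory GRing.Theory Num.Theory.
Local Open Scope classical_set_scope.
Local Open Scope ring_scope.
Local Open Scope complex_scope.

(** Write [s_A] for the inner product of [A xi] with [xi]. As [A] is unitary,
    [|A xi - s_A xi|^2 = 1 - |s_A|^2 <= 2 eps], so every coordinate of [A xi]
    is close to [s_A] times that of [xi]. Some coordinate [i0] of [xi] has
    modulus at least [1/n]. A monomial matrix permutes the coordinates up to
    unit factors, so on the whole orbit of [i0] under the permutations
    underlying the group, [|xi_i|] is bounded below, and the quotients
      [b_A(i) = (A xi)_i / xi_i]
    are all relatively close to the single number [s_A]. These quotients form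
    an exact multiplicative cocycle, [b_(AB)(i) = b_A(i) b_B(sigma_A i)], where
    [sigma_A] is the permutation underlying [A].

    The point is that a cocycle which is nearly constant in [i] is cohomologous
    to a character. Let [m] be the size of the orbit. The product of [b_A] over
    the orbit is exactly multiplicative in [A]; let [mu_A] be an [m]-th root of it
    close to [s_A]. There is one whose distance to [s_A] is linear in the error
    ([root_near1]). Then [mu_A mu_B / mu_(AB)] is an [m]-th root of unity
    close to 1, hence equal to 1 ([unity_root_near1_eq1]), and [mu] is a
    character ([near_const_cocycle_character]). On the stabiliser of [i0] the
    ratio [b_A(i0) / mu_A] is another character with all its values, hence all
    powers of each value, close to 1, so it is trivial ([powers_near1_eq1]).
    Consequently [eta_j = mu_B / b_B(i0)] does not depend on the choice of [B]
    in the group carrying [i0] to [j], and it satisfies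
    [b_A(i) eta_(sigma_A i) = mu_A eta_i]
    ([near_const_cocycle_coboundary]). The vector with coordinates [xi_i eta_i]
    on the orbit and 0 elsewhere is then an eigenvector of every [A], with
    eigenvalue [mu_A]. *)

(** * Numbers close to 1 *)

Section NearOne.
Set Implicit Arguments.
Unset Strict Implicit.

(** The logarithmic derivative [P'(1)/P(1)] is the sum of the [1/(1 - w)], each of
    modulus at most [1/d].
    The bound is kept free of divisions so that 1 may be a root. *)
Lemma le_log_deriv_at1 (C : numFieldType) (d : C) (r : seq C)
    (P := \prod_(w <- r) ('X - w%:P)) :
  0 <= d -> (forall w, w \in r -> d <= `|1 - w|) ->
  d * `|P^`().[1]| <= (size r)%:R * `|P.[1]|.
Proof.
move=> d0; rewrite {}/P; elim: r => [|a r IH] far.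
  by rewrite big_nil derivC horner0 normr0 mulr0 mul0r.
rewrite big_cons derivM derivXsubC mul1r !hornerE /= normrM.
set Q := \prod_(w <- r) _ in IH *.
have /IH leQ w : w \in r -> d <= `|1 - w|.
  by move=> wr; apply: far; rewrite inE wr orbT.
have da : d <= `|1 - a| by apply: far; rewrite mem_head.
apply: (@le_trans _ _ (d * (`|Q.[1]| + `|1 - a| * `|Q^`().[1]|))).
  by rewrite ler_wpM2l // -normrM ler_normD.
rewrite mulrDr -natr1 mulrDl mul1r addrC lerD //; last by rewrite ler_wpM2r.
by rewrite mulrCA [leRHS]mulrCA ler_wpM2l.
Qed.

(** The bound comes from the logarithmic derivative of [X^m - z] at 1: if [w] is
    the root nearest to 1, at distance [d], then [d m <= m |1 - z|]. Bounding
    only the product of the distances by [|1 - z|] would merely give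
    [|1 - w| <= |1 - z|^(1/m)]. *)
Lemma root_near1 (C : numClosedFieldType) (m : nat) (z : C) :
  (0 < m)%N -> exists2 w : C, w ^+ m = z & `|1 - w| <= `|1 - z|.
Proof.
move=> m0; pose p := 'X^m - z%:P : {poly C}.
have [r] := closed_field_poly_normal p.
have -> : lead_coef p = 1 by apply/monicP/monicXnsubC.
rewrite scale1r => Dp.
have szr : size r = m.
  by apply/eqP; rewrite -eqSS -(size_prod_XsubC r id) -Dp size_XnsubC.
pose dist1 (i : 'I_m) : C := `|1 - r`_i|.
have [i _ nearest] : extremum_spec <=%O xpredT dist1 [arg min_(i < Ordinal m0) dist1 i]%O.
  by apply: real_arg_minP => // i _; exact: normr_real.
exists r`_i.
  have : root p r`_i by rewrite Dp root_prod_XsubC mem_nth ?szr.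
  by rewrite /root /p hornerD hornerN hornerXn hornerC subr_eq0 => /eqP.
have p1 : p.[1] = 1 - z by rewrite /p hornerD hornerN hornerXn hornerC expr1n.
have p'1 : p^`().[1] = m%:R.
  by rewrite /p derivB derivC subr0 derivXn hornerMn hornerXn expr1n.
have := @le_log_deriv_at1 _ (dist1 i) r (normr_ge0 _).
rewrite -Dp p1 p'1 szr normr_nat mulrC ler_pM2l ?ltr0n //; apply=> w /(nthP 0)[j].
by rewrite szr => jm <-; exact: (nearest (Ordinal jm)).
Qed.

Lemma prod_near1 (C : numFieldType) (I : finType) (O : {set I}) (x : I -> C) (d : C) :
  0 <= d -> 2 * #|O|%:R * d <= 1 ->
  (forall i, i \in O -> `|x i - 1| <= d) ->
  `|\prod_(i in O) x i - 1| <= 2 * #|O|%:R * d.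
Proof.
move=> d0; rewrite -big_enum cardE => Od near1.
have {}near1 i : i \in enum O -> `|x i - 1| <= d by rewrite mem_enum => /near1.
elim: (enum O) Od near1 => [|a r IH] Od near1.
  by rewrite big_nil subrr normr0 mulr0 mul0r.
have rd : 2 * (size r)%:R * d <= 1.
  by apply: le_trans Od; rewrite ler_wpM2r // ler_wpM2l // ler_nat /=.
have {}IH := IH rd (fun i ir => near1 i (@mem_behead _ (a :: r) i ir)).
rewrite big_cons; set p := \prod_(j <- r) x j in IH *.
have -> : x a * p - 1 = (x a - 1) * (p - 1) + (x a - 1) + (p - 1) by ring.
have xa : `|x a - 1| <= d by rewrite near1 ?mem_head.
have p1 : `|p - 1| <= 1 by exact: le_trans rd.
have -> : 2 * (size (a :: r))%:R * d = 2 * d + 2 * (size r)%:R * d.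
  by rewrite /= -natr1; ring.
rewrite (le_trans (ler_normD _ _)) // lerD //.
rewrite mulr_natl mulr2n (le_trans (ler_normD _ _)) // lerD //.
by rewrite normrM -[d]mulr1 ler_pM.
Qed.

Lemma dist1_exp (C : numFieldType) (x : C) (k : nat) :
  `|x| <= 1 -> `|x ^+ k - 1| <= k%:R * `|x - 1|.
Proof.
move=> x1; elim: k => [|k IH]; first by rewrite subrr normr0 mul0r.
have -> : x ^+ k.+1 - 1 = x * (x ^+ k - 1) + (x - 1) by rewrite exprS; ring.
rewrite -natr1 mulrDl mul1r (le_trans (ler_normD _ _)) // lerD // normrM.
by rewrite (le_trans _ IH) // ler_piMl.
Qed.

(** If the first [k] powers of [x] are within 1/2 of 1, their sum has modulus at
    least [k/2], and [x^k - 1] is [x - 1] times that sum. *)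
Lemma powers_near1_escape (C : numFieldType) (x : C) (k : nat) :
  (forall j, (j < k)%N -> `|x ^+ j - 1| <= 2^-1) ->
  k%:R * `|x - 1| <= 2 * `|x ^+ k - 1|.
Proof.
move=> near1; rewrite subrX1 normrM mulrC mulrCA ler_wpM2l //.
set S := \sum_(i < k) x ^+ i.
have kS : `|k%:R - S| <= k%:R / 2.
  have -> : k%:R - S = \sum_(i < k) (1 - x ^+ i).
    by rewrite sumrB sumr_const card_ord.
  have -> : k%:R / 2 = \sum_(i < k) 2^-1 :> C.
    by rewrite sumr_const card_ord mulr_natl.
  rewrite (le_trans (ler_norm_sum _ _ _)) // ler_sum // => i _.
  by rewrite distrC near1.
have : `|k%:R : C| <= `|S| + `|k%:R - S|.
  by rewrite -{1}[k%:R](subrK S) addrC ler_normD.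
rewrite normr_nat => /le_trans /(_ (lerD (lexx _) kS)).
by rewrite -lerBlDr -{1}[k%:R](@mulfK _ 2) ?pnatr_eq0 // -mulrBl mulr_natr
  mulr2n addrK ler_pdivrMr // mulrC.
Qed.

Lemma unity_root_near1_eq1 (C : numFieldType) (x : C) (m : nat) :
  (0 < m)%N -> x ^+ m = 1 -> 2 * m%:R * `|x - 1| <= 1 -> x = 1.
Proof.
move=> m0 xm xnear.
have x1 : `|x| <= 1 by rewrite -(@expr_le1 _ m) // -normrX xm normr1.
have := @powers_near1_escape _ x m.
rewrite xm subrr normr0 mulr0 => escape; apply/eqP; rewrite -subr_eq0 -normr_eq0.
rewrite -(mulrI_eq0 _ (@lregP _ m%:R _)) ?pnatr_eq0 -?lt0n // eq_le mulr_ge0 // andbT.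
apply: escape => j jm; rewrite (le_trans (dist1_exp _ x1)) //.
rewrite -[leRHS]mul1r ler_pdivlMr // mulrC mulrA (le_trans _ xnear) //.
by rewrite ler_wpM2r // ler_wpM2l // ler_nat ltnW.
Qed.

Lemma quotient_near1 (R : rcfType) (x w : R[i]) (a b g : R) :
  `|x - 1| <= a%:C -> `|w - 1| <= b%:C -> b < 1 -> a + b <= g * (1 - b) ->
  `|x / w - 1| <= g%:C.
Proof.
move=> xa wb b1 abg.
have le_w : (1 - b)%:C <= `|w|.
  rewrite rmorphB rmorph1 lerBlDr addrC -lerBlDr.
  by rewrite (le_trans _ wb) // distrC -{1}[1 : R[i]]normr1 lerB_dist.
have w0 : 0 < `|w| by rewrite (lt_le_trans _ le_w) // ltcR subr_gt0.
have wn0 : w != 0 by rewrite -normr_gt0.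
have g0 : 0 <= g.
  have a0 : 0 <= a by rewrite -ler0c (le_trans _ xa).
  have b0 : 0 <= b by rewrite -ler0c (le_trans _ wb).
  by rewrite -(@pmulr_lge0 _ (1 - b)) ?subr_gt0 // (le_trans _ abg) // addr_ge0.
have -> : x / w - 1 = ((x - 1) - (w - 1)) / w by field.
rewrite normrM normfV ler_pdivrMr // (le_trans (ler_normB _ _)) //.
rewrite (le_trans (lerD xa wb)) // -rmorphD (@le_trans _ _ (g * (1 - b))%:C) ?lecR //.
by rewrite rmorphM ler_wpM2l // ler0c.
Qed.

(** If [x] differs from 1, then [k |x - 1| <= 1] for every [k]
    ([powers_near1_escape]), against the archimedean property of the reals. *)
Lemma powers_near1_eq1 (R : realType) (x : R[i]) :
  (forall k, `|x ^+ k - 1| <= 2^-1) -> x = 1.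
Proof.
move=> near1; apply/eqP; rewrite -subr_eq0; apply/negP => /negP x1.
pose e := ComplexField.Normc.normc (x - 1).
have eE : `|x - 1| = e%:C by [].
have e0 : 0 < e by rewrite -ltcR -eE normr_gt0.
have := archi_boundP (ltW (_ : 0 < e^-1)); rewrite invr_gt0 => /(_ e0).
set k := Num.bound _ => ke.
have : k%:R * `|x - 1| <= 1.
  rewrite (le_trans (@powers_near1_escape _ x k (fun j _ => near1 j))) //.
  by rewrite -ler_pdivlMl // mulr1.
rewrite eE -[k%:R](rmorph_nat (real_complex R)) -rmorphM lecR leNgt => /negP; apply.
by rewrite -ltr_pdivrMr // mul1r.
Qed.
End NearOne.

(** * The permutation action of a monomial group *)

Section Monomial.
Set Implicit Arguments.
Unset Strict Implicit.
Variables (R : realType) (n : nat) (G : set 'M[R[i]]_n).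
Hypotheses (Ggrp : unitary_group G) (Gmon : monomial G).
Local Notation C := R[i].

(** With this row convention [(A v)_i] is [A i (absperm A i)] times
    [v_(absperm A i)], so [absperm] turns products of matrices into composition in
    the order of reading. *)
Definition absperm (A : 'M[C]_n) : 'S_n :=
  odflt 1%g [pick s | map_mx (fun z : C => `|z|) A == perm_mx s].

Lemma norm_entry A i j : G A -> `|A i j| = (absperm A i == j)%:R.
Proof.
move=> GA; have <- : (perm_mx (absperm A) : 'M[C]_n) i j = (absperm A i == j)%:R.
  by rewrite !mxE.
rewrite /absperm; case: pickP => [s /eqP <-|no]; first by rewrite mxE.
by have /existsP[s /eqP As] := Gmon GA; have := no s; rewrite As eqxx.
Qed.

Lemma norm_absperm_entry A i : G A -> `|A i (absperm A i)| = 1.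
Proof. by move=> GA; rewrite norm_entry // eqxx. Qed.

Lemma absperm_eq A i j : G A -> A i j != 0 -> absperm A i = j.
Proof. by move=> GA; rewrite -normr_eq0 norm_entry // pnatr_eq0 eqb0 negbK => /eqP. Qed.

Lemma absperm_entry_neq0 A i : G A -> A i (absperm A i) != 0.
Proof. by move=> GA; rewrite -normr_eq0 norm_absperm_entry // oner_eq0. Qed.

Lemma mulmx_absperm p A (B : 'M[C]_(n, p)) i j :
  G A -> (A *m B) i j = A i (absperm A i) * B (absperm A i) j.
Proof.
move=> GA; rewrite mxE (bigD1 (absperm A i)) //= big1 ?addr0 // => k.
by apply: contraNeq; rewrite mulf_eq0 => /norP[/(absperm_eq GA) -> _].
Qed.

Lemma abspermM A B i : G A -> G B -> absperm (A *m B) i = absperm B (absperm A i).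
Proof.
move=> GA GB; apply: absperm_eq; first exact: (unitary_groupM Ggrp).
by rewrite mulmx_absperm // mulf_neq0 ?absperm_entry_neq0.
Qed.

Lemma group_unitmx A : G A -> A \in unitmx.
Proof. by move/(unitary_group_unitary Ggrp); apply: unitarymx_unit. Qed.

Lemma absperm1 i : absperm 1%:M i = i.
Proof.
by apply: absperm_eq; [exact: (unitary_group1 Ggrp) | rewrite mxE eqxx oner_eq0].
Qed.

Lemma abspermV A i : G A -> absperm (invmx A) (absperm A i) = i.
Proof.
move=> GA; rewrite -abspermM ?mulmxV ?absperm1 ?group_unitmx //.
exact: (unitary_groupV Ggrp).
Qed.

Variable i0 : 'I_n.

Definition orb : {set 'I_n} := finset (fun j => `[< exists2 A, G A & absperm A i0 = j >]).

Lemma orbP j : reflect (exists2 A, G A & absperm A i0 = j) (j \in orb).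
Proof. by rewrite inE; apply: asboolP. Qed.

Lemma mem_orb : i0 \in orb.
Proof. by apply/orbP; exists 1%:M; rewrite ?absperm1 //; apply: unitary_group1. Qed.

Lemma absperm_orb A i : G A -> (absperm A i \in orb) = (i \in orb).
Proof.
move=> GA; have GV := unitary_groupV Ggrp GA.
have step B j : G B -> j \in orb -> absperm B j \in orb.
  move=> GB /orbP[D GD <-]; apply/orbP; exists (D *m B); last exact: abspermM.
  exact: (unitary_groupM Ggrp).
by apply/idP/idP; [rewrite -{2}(abspermV i GA) | ]; apply: step.
Qed.

Lemma orb_gt0 : (0 < #|orb|)%N.
Proof. by apply/card_gt0P; exists i0; apply: mem_orb. Qed.

(** * Nearly constant cocycles on an orbit *)

Section Cocycle.
Variable b : 'M[C]_n -> 'I_n -> C.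
Hypothesis bM : forall A B i, G A -> G B -> i \in orb ->
  b (A *m B) i = b A i * b B (absperm A i).

Lemma prod_cocycleM A B : G A -> G B ->
  \prod_(i in orb) b (A *m B) i = \prod_(i in orb) b A i * \prod_(i in orb) b B i.
Proof.
move=> GA GB; rewrite [X in _ = _ * X](reindex_inj (@perm_inj _ (absperm A))) /=.
under [X in _ = _ * X]eq_bigl => i do rewrite absperm_orb //.
by rewrite -big_split; apply: eq_bigr => i iO; rewrite bM.
Qed.

(** [mu A] is chosen so that its [m]-th power is the product of [b A] over the orbit. With
    [t = 1/m] the hypothesis reads [d <= t^2/40]: the product of the [m] factors
    [b A i / s] is within [2 m d <= t/20] of 1, so [b A i / mu A] is within
    [t/12] of 1, and the defect of multiplicativity of [mu] is within [t/2] of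
    1, as close as [unity_root_near1_eq1] asks. *)
Lemma near_const_cocycle_character (d : R) :
  0 <= d -> 40 * #|orb|%:R ^+ 2 * d <= 1 ->
  (forall A, G A -> exists2 s : C, s != 0 &
     forall i, i \in orb -> `|b A i / s - 1| <= d%:C) ->
  exists mu : 'M[C]_n -> C,
    (forall A B, G A -> G B -> mu (A *m B) = mu A * mu B) /\
    forall A, G A -> mu A != 0 /\
      forall i, i \in orb -> `|b A i / mu A - 1| <= ((12 * #|orb|%:R)^-1)%:C.
Proof.
move=> d0 dsmall near_s; pose m := #|orb|; have m0 : (0 < m)%N := orb_gt0.
have m1 : 1 <= m%:R :> R by rewrite ler1n.
pose t : R := m%:R^-1.
have tm : t * m%:R = 1 by rewrite mulVf // pnatr_eq0 -lt0n.
have t0 : 0 < t by rewrite invr_gt0 ltr0n.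
have t1 : t <= 1 by nra.
have dt : 40 * d <= t ^+ 2.
  have -> : 40 * d = t ^+ 2 * (40 * m%:R ^+ 2 * d).
    transitivity ((t * m%:R) ^+ 2 * (40 * d)); last by ring.
    by rewrite tm expr1n mul1r.
  by rewrite ler_piMr // sqr_ge0.
have {dsmall}-> : (12 * #|orb|%:R)^-1 = t / 12 by rewrite invfM mulrC.
have root A : exists z : C, G A -> [/\ z != 0,
    z ^+ m = \prod_(i in orb) b A i
  & forall i, i \in orb -> `|b A i / z - 1| <= (t / 12)%:C].
  have [GA|//] := pselect (G A); last by exists 0.
  have [s s0 near1] := near_s A GA.
  pose p := \prod_(i in orb) (b A i / s).
  have p1 : `|p - 1| <= (t / 20)%:C.
    have dmE : 2 * m%:R * d%:C = (2 * m%:R * d)%:C :> C.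
      by rewrite !rmorphM /= !rmorph_nat.
    have dm : 2 * m%:R * d <= t / 20 by nra.
    apply: le_trans (_ : 2 * m%:R * d%:C <= _); last by rewrite dmE lecR.
    apply: prod_near1 => //; first by rewrite ler0c.
    by rewrite -/m dmE lecR; nra.
  have [w wm w1] := root_near1 p m0.
  have {}w1 : `|w - 1| <= (t / 20)%:C by rewrite distrC (le_trans w1) // distrC.
  have w0 : w != 0.
    apply: contraTneq w1 => ->; rewrite sub0r normrN1 -[1]/(1%:C) lecR -ltNge; lra.
  exists (s * w) => _; split; first by rewrite mulf_neq0.
    rewrite exprMn wm /p big_split /= prodfV prodr_const -/m mulrC divfK //.
    by rewrite expf_neq0.
  move=> i iO; rewrite invfM mulrA.
  by apply: (quotient_near1 (near1 i iO) w1); nra.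
have [mu muP] := boolp.choice root.
exists mu; split; last by move=> A /muP[].
move=> A B GA GB; have GAB := unitary_groupM Ggrp GA GB.
have [[A0 Am A1] [B0 Bm B1] [AB0 ABm AB1]] := And3 (muP A GA) (muP B GB) (muP _ GAB).
suff c1 : mu A * mu B / mu (A *m B) = 1 by rewrite -[RHS](divfK AB0) c1 mul1r.
apply: (unity_root_near1_eq1 m0).
  rewrite exprMn exprVn exprMn Am Bm ABm prod_cocycleM // divff // -Am -Bm.
  by rewrite mulf_neq0 // expf_neq0.
set c := _ / _.
suff c_near : `|c - 1| <= (t / 2)%:C.
  have mt : 2 * m%:R * (t / 2)%:C = 1 :> C.
    have -> : 2 * m%:R * (t / 2)%:C = (2 * m%:R * (t / 2))%:C.
      by rewrite [in RHS]rmorphM [in RHS](rmorphM _ 2) /= !rmorph_nat.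
    by rewrite mulrC mulrA divfK ?pnatr_eq0 // tm.
  by rewrite -[leRHS]mt ler_wpM2l // mulr_ge0 // ler0n.
have near_neq0 D j : `|b D j / mu D - 1| <= (t / 12)%:C -> b D j != 0.
  apply: contraTneq => ->.
  by rewrite mul0r sub0r normrN1 -[1]/(1%:C) lecR -ltNge; lra.
have iO := mem_orb; have sO : absperm A i0 \in orb by rewrite absperm_orb.
have bA0 := near_neq0 _ _ (A1 _ iO); have bB0 := near_neq0 _ _ (B1 _ sO).
(* The factors [b] cancel by the cocycle identity, which leaves a quotient of
   three numbers within [t/12] of 1. *)
pose x := b A i0 / mu A; pose y := b B (absperm A i0) / mu B.
have -> : c = (b (A *m B) i0 / mu (A *m B)) / (x * y).
  by rewrite bM // /c /x /y; field; rewrite bA0 bB0 A0 B0 AB0.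
apply: (@quotient_near1 _ _ _ _ (t / 4) _ (AB1 _ iO)); [|lra|nra].
have -> : x * y - 1 = (x - 1) * (y - 1) + (x - 1) + (y - 1) by ring.
have -> : (t / 4)%:C = (t / 12)%:C + (t / 12)%:C + (t / 12)%:C :> C.
  by rewrite -!rmorphD /=; congr (_%:C); field.
rewrite (le_trans (ler_normD _ _)) // lerD ?B1 //.
rewrite (le_trans (ler_normD _ _)) // lerD ?A1 //.
rewrite normrM -[leRHS]mul1r ler_pM ?B1 // (le_trans (A1 _ iO)) //.
by rewrite -[leRHS]/(1%:C) lecR; lra.
Qed.

(** The coboundary is [eta j = mu B / b B i0], for any [B] carrying [i0] to [j].
    This is the only value compatible with [eta i0 = 1], and it is independent
    of [B] because [b _ i0] and [mu] agree on the stabiliser of [i0]. *)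
Lemma near_const_cocycle_coboundary (d : R) :
  0 <= d -> 40 * #|orb|%:R ^+ 2 * d <= 1 ->
  (forall A, G A -> exists2 s : C, s != 0 &
     forall i, i \in orb -> `|b A i / s - 1| <= d%:C) ->
  exists (mu : 'M[C]_n -> C) (eta : 'I_n -> C),
    (forall i, i \in orb -> eta i != 0) /\
    forall A i, G A -> i \in orb -> b A i * eta (absperm A i) = mu A * eta i.
Proof.
move=> d0 dsmall /(near_const_cocycle_character d0 dsmall)[mu [muM mu_near]].
have m1 : 1 <= #|orb|%:R :> R by rewrite ler1n orb_gt0.
have near_half A i : G A -> i \in orb -> `|b A i / mu A - 1| <= (2^-1)%:C.
  move=> GA iO; have [_ /(_ i iO)/le_trans] := mu_near A GA; apply.
  by rewrite lecR lef_pV2 ?posrE; lra.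
have mu0 A : G A -> mu A != 0 by case/mu_near.
have b0 A i : G A -> i \in orb -> b A i != 0.
  move=> GA iO; apply: contraTneq (near_half A i GA iO) => ->.
  by rewrite mul0r sub0r normrN1 -[1]/(1%:C) lecR -ltNge; lra.
(* On the stabiliser of [i0], [b _ i0] is itself a character. *)
have stab D : G D -> absperm D i0 = i0 -> b D i0 = mu D.
  move=> GD fixD; suff /(canRL (divfK (mu0 _ GD))) : b D i0 / mu D = 1 by rewrite mul1r.
  apply: powers_near1_eq1 => k.
  have -> : 2^-1 = (2^-1)%:C :> C by rewrite fmorphV rmorph_nat.
  case: k => [|k]; first by rewrite expr0 subrr normr0 ler0c invr_ge0 ler0n.
  suff [E GE [fixE ->]] : exists2 E, G E &
      absperm E i0 = i0 /\ (b D i0 / mu D) ^+ k.+1 = b E i0 / mu E.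
    by apply: near_half => //; exact: mem_orb.
  elim: k => [|k [E GE [fixE IH]]]; first by exists D; rewrite ?expr1.
  exists (D *m E); first exact: (unitary_groupM Ggrp).
  rewrite abspermM // fixD fixE exprS IH bM ?mem_orb // muM // fixD.
  by split=> //; field; rewrite !mu0.
(* [B] and [B'] differ by an element of the stabiliser. *)
have ratio B B' : G B -> G B' -> absperm B i0 = absperm B' i0 ->
    mu B / b B i0 = mu B' / b B' i0.
  move=> GB GB' eqs; have GV := unitary_groupV Ggrp GB'.
  pose D := B *m invmx B'; have GD : G D by exact: (unitary_groupM Ggrp).
  have fixD : absperm D i0 = i0 by rewrite abspermM // eqs abspermV.
  have -> : B = D *m B' by rewrite mulmxKV ?group_unitmx.
  rewrite muM // bM ?mem_orb // fixD stab //.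
  by field; rewrite mu0 // b0 ?mem_orb.
have reach j : exists B, j \in orb -> G B /\ absperm B i0 = j.
  by have [/orbP[A GA <-]|_] := boolP (j \in orb); [exists A | exists 0].
have [B BP] := boolp.choice reach.
exists mu, (fun j => mu (B j) / b (B j) i0); split=> [i iO|A i GA iO].
  by have [GBi _] := BP i iO; rewrite mulf_neq0 ?invr_neq0 ?mu0 ?b0 ?mem_orb.
have [GBi Bi] := BP i iO; have [|GBs Bs] := BP (absperm A i); first by rewrite absperm_orb.
have GBA := unitary_groupM Ggrp GBi GA.
rewrite (ratio _ (B i *m A)) //; last by rewrite abspermM // Bi Bs.
rewrite muM // bM ?mem_orb // Bi.
by field; rewrite !b0 ?mem_orb.
Qed.
End Cocycle.

Lemma near_eigenvector_on_orbit (xi : 'cV[C]_n) (d : R) :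
  (forall i, i \in orb -> xi i 0 != 0) ->
  0 <= d -> 40 * #|orb|%:R ^+ 2 * d <= 1 ->
  (forall A, G A -> exists2 s : C, s != 0 &
     forall i, i \in orb -> `|(A *m xi) i 0 / xi i 0 / s - 1| <= d%:C) ->
  exists2 zeta : 'cV[C]_n, zeta != 0 &
    forall A, G A -> exists lambda : C, A *m zeta = lambda *: zeta.
Proof.
move=> xi0 d0 dsmall near_s.
pose b A i := (A *m xi) i 0 / xi i 0.
have bM A B i : G A -> G B -> i \in orb -> b (A *m B) i = b A i * b B (absperm A i).
  move=> GA GB iO; rewrite /b -mulmxA !(mulmx_absperm _ _ _ GA).
  by field; rewrite !xi0 // absperm_orb.
have [mu [eta [eta0 coboundary]]] :=
  near_const_cocycle_coboundary bM d0 dsmall near_s.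
pose zeta : 'cV[C]_n := \col_i (if i \in orb then xi i 0 * eta i else 0).
exists zeta.
  apply/negP => /eqP/colP/(_ i0)/eqP; apply/negP.
  by rewrite !mxE mem_orb mulf_neq0 ?xi0 ?eta0 ?mem_orb.
move=> A GA; exists (mu A); apply/colP => i; rewrite mulmx_absperm // !mxE absperm_orb //.
case: ifPn => iO; last by rewrite !mulr0.
rewrite [RHS]mulrCA -coboundary // /b mulmx_absperm //.
by field; rewrite xi0.
Qed.
End Monomial.

(** * Unit vectors that are almost fixed *)

Section AlmostFixed.
Set Implicit Arguments.
Unset Strict Implicit.
Variables (R : realType) (n : nat).
Local Notation C := R[i].

Lemma inner_sqr (u : 'cV[C]_n) : inner u u = \sum_i `|u i 0| ^+ 2.
Proof. by rewrite innerE; apply: eq_bigr => i _; rewrite normCK. Qed.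

Lemma enorm_eq1 (u : 'cV[C]_n) : enorm u = 1 -> inner u u = 1.
Proof. by move=> u1; rewrite -[LHS]sqrtCK -/(enorm u) u1 expr1n. Qed.

Lemma normalized_eigenvector (G : set 'M[C]_n) (v : 'cV[C]_n) :
  v != 0 -> (forall A, G A -> exists lambda : C, A *m v = lambda *: v) ->
  exists zeta, is_common_eigenvector G zeta.
Proof.
move=> v0 eigen; exists ((enorm v)^-1 *: v); split; last first.
  by move=> A /eigen[l Av]; exists l; rewrite -scalemxAr Av scalerA mulrC -scalerA.
have v_pos : 0 < inner v v.
  rewrite lt_def inner_sqr sumr_ge0 ?andbT => [|i _]; last by rewrite exprn_ge0.
  apply: contraNneq v0 => /psumr_eq0P s0; apply/eqP/colP => i; rewrite mxE.
  apply/eqP; rewrite -normr_eq0 -sqrf_eq0 s0 // => j _; exact: exprn_ge0.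
have N0 : 0 < enorm v by rewrite sqrtC_gt0.
rewrite /enorm -(@sqrtC1 C); congr sqrtC; rewrite inner_sqr.
under eq_bigr do rewrite mxE normrM exprMn.
rewrite -mulr_sumr -inner_sqr normfV (gtr0_norm N0) exprVn sqrtCK mulVf //.
exact: lt0r_neq0.
Qed.

(** [inner u v *: v] is the orthogonal projection of [u] on the line of [v], so by
    Pythagoras the whole vector [u - inner u v *: v] has squared norm
    [1 - |inner u v|^2]. *)
Lemma unit_dist_sqr (u v : 'cV[C]_n) (i : 'I_n) : inner u u = 1 -> inner v v = 1 ->
  `|u i 0 - inner u v * v i 0| ^+ 2 <= 1 - `|inner u v| ^+ 2.
Proof.
move=> u1 v1; move sE: (inner u v) => s.
have -> : 1 - `|s| ^+ 2 = \sum_j `|u j 0 - s * v j 0| ^+ 2.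
  transitivity (inner u u - s^* * inner u v - s * (inner u v)^* + s * s^* * inner v v).
    by rewrite sE u1 v1 normCK; ring.
  rewrite !innerE rmorph_sum !mulr_sumr -!sumrB -big_split /=.
  apply: eq_bigr => j _; rewrite normCK !rmorphB !rmorphM /= conjCK; ring.
rewrite (bigD1 i) //= lerDl sumr_ge0 // => j _; exact: exprn_ge0.
Qed.

Lemma inner_monomial (G : set 'M[C]_n) A u : monomial G -> G A ->
  inner (A *m u) (A *m u) = inner u u.
Proof.
move=> Gmon GA; rewrite !inner_sqr [RHS](reindex_inj (@perm_inj _ (absperm A))) /=.
by apply: eq_bigr => i _; rewrite (mulmx_absperm Gmon) // normrM
  (norm_absperm_entry Gmon) // mul1r.
Qed.

Lemma large_coordinate (u : 'cV[C]_n) :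
  (0 < n)%N -> inner u u = 1 -> exists i, (n%:R^-1)%:C <= `|u i 0|.
Proof.
move=> n0 u1; have nR0 : 0 < n%:R :> C by rewrite ltr0n.
suff [i big_i] : exists i, n%:R^-1 <= `|u i 0| ^+ 2.
  exists i; rewrite -(@ler_pXn2r _ 2) ?nnegrE ?normr_ge0 ?ler0c ?invr_ge0 ?ler0n //.
  rewrite fmorphV rmorph_nat.
  by rewrite (le_trans _ big_i) // exprVn lef_pV2 ?posrE ?exprn_gt0 // expr2
    ler_peMl ?ler1n ?ler0n.
apply: contrapT => small.
suff: 1 < 1 :> C by rewrite ltxx.
rewrite -{1}u1 inner_sqr (lt_le_trans (ltr_sum (G := fun=> n%:R^-1) _ _)) //.
- by apply/hasP; exists (Ordinal n0); rewrite ?mem_index_enum.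
- move=> i _; rewrite real_ltNge ?ger0_real ?exprn_ge0 ?invr_ge0 ?ler0n //.
  by apply/negP => big_i; apply: small; exists i.
- by rewrite sumr_const card_ord -[_ *+ n]mulr_natr mulVf // gt_eqF.
Qed.

(** Here [t] stands for [1/n], [S] for the modulus of the inner product of [A xi]
    with [xi], and [d] for a coordinate of [A xi - s xi]. One factor [t <= 1/2]
    turns [2 eps < t^11/1800] into the square [t^10/3600]. *)
Lemma eps_bounds (eps t S d : R) :
  eps < t ^+ 11 / 3600 -> 0 < t -> t <= 2^-1 -> 1 - eps <= S -> 0 <= d ->
  d ^+ 2 <= 1 - S ^+ 2 -> d <= t ^+ 5 / 60 /\ 3 / 4 <= S.
Proof.
move=> eps_small t0 t2 epsS d0 dS.
have t11 : t ^+ 11 <= t ^+ 10 / 2 by rewrite exprSr ler_wpM2l // exprn_ge0 // ltW.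
have t10 : t ^+ 10 <= 1 by rewrite exprn_ile1 //; lra.
have S34 : 3 / 4 <= S by lra.
split=> //; rewrite -(@ler_pXn2r _ 2) ?nnegrE ?divr_ge0 ?exprn_ge0 ?ler0n ?(ltW t0) //.
have -> : (t ^+ 5 / 60) ^+ 2 = t ^+ 10 / 3600 by field.
nra.
Qed.
End AlmostFixed.

(** * Common eigenvectors *)

Theorem theorem5p2 (R : realType) (n : nat) (eps : R) :
  0 < eps ->
  (2 <= n)%N ->
  eps < 1 / (3600 * n%:R ^+ 11) ->
  forall G : set 'M[R[i]]_n,
    unitary_group G -> monomial G ->
    (exists xi : 'cV[R[i]]_n, weak_approx_fixed_point eps G xi) ->
    exists zeta : 'cV[R[i]]_n, is_common_eigenvector G zeta.
Proof.
move=> _ n2 eps_small G Ggrp Gmon [xi [_ /enorm_eq1 xi1 near_fixed]].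
pose t : R := n%:R^-1; have n0 : 0 < n%:R :> R by rewrite ltr0n ltnW.
have t0 : 0 < t by rewrite invr_gt0.
have t2 : t <= 2^-1 by rewrite lef_pV2 ?posrE // ler_nat.
have {}eps_small : eps < t ^+ 11 / 3600.
  by rewrite /t exprVn -invfM mulrC -div1r.
have [i0 big0] := large_coordinate (ltnW n2) xi1; rewrite -/t in big0.
have close A i : G A -> `|(A *m xi) i 0 - inner (A *m xi) xi * xi i 0| <= (t ^+ 5 / 60)%:C
    /\ (3 / 4)%:C <= `|inner (A *m xi) xi|.
  move=> GA; rewrite !lecR; apply: (@eps_bounds _ eps) => //.
  - by rewrite -lecR; exact: near_fixed.
  - by rewrite -ler0c -[_%:C]/`|(A *m xi) i 0 - inner (A *m xi) xi * xi i 0| normr_ge0.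
  rewrite -lecR rmorphXn rmorphB rmorph1 rmorphXn /=.
  by apply: unit_dist_sqr; rewrite ?(inner_monomial _ Gmon GA).
have big_orb i : i \in orb G i0 -> (t / 2)%:C <= `|xi i 0|.
  move=> /orbP[A GA <-]; have [close0 S34] := close A i0 GA.
  rewrite -[`|xi _ 0|]mul1r -(norm_absperm_entry Gmon i0 GA) -normrM -(mulmx_absperm Gmon) //.
  set u := (A *m xi) i0 0 in close0 *; set s := inner _ _ in close0 S34.
  have t5 : t ^+ 5 <= t / 16.
    by rewrite exprS ler_wpM2l ?(ltW t0) // (le_trans (lerXn2r 4 _ _ t2)) ?nnegrE //; lra.
  have: `|s * xi i0 0| <= `|u| + (t ^+ 5 / 60)%:C.
    rewrite -lerBlDl (le_trans _ close0) // distrC lerB_dist //.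
  rewrite normrM; move: S34 big0; rewrite !lecR -rmorphM -rmorphD !lecR => S34 big0 su.
  nra.
have xi0 i : i \in orb G i0 -> xi i 0 != 0.
  move=> /big_orb; apply: contraTneq => ->; rewrite normr0 -[0]/(0%:C) lecR; lra.
have orb_n : #|orb G i0|%:R <= n%:R :> R by rewrite ler_nat -[n in leqRHS]card_ord max_card.
(* [t^4/15] exceeds [(t^5/60) / ((t/2)(3/4))], the error on [A xi - s xi] over
   the lower bounds for a coordinate of [xi] on the orbit and for [|s|]. *)
have [zeta zeta0 eigen] : exists2 zeta : 'cV[R[i]]_n, zeta != 0 &
    forall A, G A -> exists lambda : R[i], A *m zeta = lambda *: zeta.
  apply: (@near_eigenvector_on_orbit _ _ _ Ggrp Gmon i0 xi (t ^+ 4 / 15)) => //.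
  - by rewrite divr_ge0 ?exprn_ge0 // ltW.
  - have tn : t * n%:R = 1 by rewrite mulVf // gt_eqF.
    have : (#|orb G i0|%:R * t) ^+ 2 <= 1.
      rewrite exprn_ile1 ?mulr_ge0 ?ler0n ?(ltW t0) //.
      by rewrite -[leRHS]tn mulrC ler_wpM2l // ltW.
    have -> : 40 * #|orb G i0|%:R ^+ 2 * (t ^+ 4 / 15) = 
      8 / 3 * ((#|orb G i0|%:R * t) ^+ 2 * t ^+ 2) :> R by field.
    have : t ^+ 2 <= 4^-1 by nra.
    nra.
  move=> A GA; have [_ S34] := close A i0 GA; set s := inner _ _ in S34.
  have s0 : s != 0.
    by apply: contraTneq S34 => ->; rewrite normr0 -[0]/(0%:C) lecR; lra.
  exists s => // i iO; have [close_i _] := close A i GA.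
  have -> : (A *m xi) i 0 / xi i 0 / s - 1 = ((A *m xi) i 0 - s * xi i 0) / (xi i 0 * s).
    by field; rewrite s0 xi0.
  rewrite normrM normfV ler_pdivrMr ?normr_gt0 ?mulf_neq0 ?xi0 //.
  rewrite (le_trans close_i) // normrM.
  move: S34 (big_orb i iO); rewrite -!rmorphM !lecR => S34 big_i.
  have le_prod := ler_pM (_ : 0 <= t / 2) (_ : 0 <= 3 / 4) big_i S34.
  rewrite (@le_trans _ _ (t ^+ 4 / 15 * (t / 2 * (3 / 4)))) //.
    have -> : t ^+ 4 / 15 * (t / 2 * (3 / 4)) = t ^+ 5 / 40 by field.
    by rewrite ler_wpM2l ?exprn_ge0 ?(ltW t0) // lef_pV2 ?posrE // ler_nat.
  by rewrite ler_wpM2l ?le_prod ?divr_ge0 ?exprn_ge0 ?(ltW t0).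
exact: normalized_eigenvector eigen.
Qed.
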